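(* Let $G$ be a simple directed $(p,q,r)$ uniformly colored graph with an even number of vertices such that the degree $s$ of each vertex coincides with the number of edge colors $p$. Then the associated 2-step nilpotent Lie algebra $\mathfrak{n}_G$ is either nonsingular or almost nonsingular.
   Context: A directed edge-labeled graph $G=(V,E,C)$ is a finite connected directed graph with vertex set $V=\{v_1,\dots,v_q\}$ and edge set $E$, together with a surjective labeling (coloring) $c:E\to C=\{Z_1,\dots,Z_p\}$. Simple means no loops and at most one edge between any two distinct vertices. Uniform coloring: let $G$ be a regular graph in which every vertex has degree $s>0$. A proper edge coloring (no two incident edges have the same color) using $p$ colors is uniform if each color is used the same number $r$ of times. If $G$ has $q$ vertices, $G$ is then called a $(p,q,r)$ uniform (uniformly colored) graph. The metric Lie algebra $\mathfrak{n}_G$: as a real vector space $\mathfrak{n}_G=\mathfrak{v}\oplus\mathfrak{w}$, where $\mathfrak{v}$ has basis $V$ and $\mathfrak{w}$ has basis $C$; the inner product makes $V\cup C$ orthonormal. The bracket is bilinear and skew-symmetric with $[v_i,v_j]=\sum_{\ell}(\epsilon_\ell-\epsilon'_\ell)Z_\ell$, where $\epsilon_\ell=1$ if $c(v_i,v_j)=Z_\ell$ and $0$ otherwise, and $\epsilon'_\ell=1$ if $c(v_j,v_i)=Z_\ell$ and $0$ otherwise, $(v,w)$ denoting an edge directed from $v$ to $w$; all other brackets of basis elements are zero. The derived algebra is $[\mathfrak{n}_G,\mathfrak{n}_G]=\mathfrak{w}$. For $Z\in[\mathfrak{n}_G,\mathfrak{n}_G]$, $j(Z):\mathfrak{v}\to\mathfrak{v}$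 is the skew-symmetric operator defined by $\langle j(Z)X,Y\rangle=\langle Z,[X,Y]\rangle$ for all $X,Y\in\mathfrak{v}$. The abelian factor is the unique subspace $\mathfrak{a}\subseteq\mathfrak{v}$ with center $\mathcal{Z}(\mathfrak{n}_G)=[\mathfrak{n}_G,\mathfrak{n}_G]\oplus\mathfrak{a}$, so that $\mathfrak{v}=\mathcal{Z}(\mathfrak{n}_G)^\perp\oplus\mathfrak{a}$. $\mathfrak{n}_G$ is singular if $j(Z)$ restricted to $\mathcal{Z}(\mathfrak{n}_G)^\perp$ is singular for all $Z\in[\mathfrak{n}_G,\mathfrak{n}_G]$; nonsingular if $\mathfrak{a}=\{0\}$ and $j(Z)$ is nonsingular for all nonzero $Z\in[\mathfrak{n}_G,\mathfrak{n}_G]$; almost nonsingular if it is neither singular nor nonsingular. *)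

(* Defs.v *)
From HB Require Import structures.
From mathcomp Require Import all_boot all_order all_algebra.
From mathcomp Require Import sesquilinear.
From mathcomp Require Import reals.

Set Implicit Arguments.
Unset Strict Implicit.
Unset Printing Implicit Defensive.

Import Order.TTheory GRing.Theory Num.Theory.

Local Open Scope ring_scope.

(* Connectedness is that of the underlying undirected graph. *)
Record labeled_digraph := LabeledDigraph {
  vertex : finType;
  color : finType;
  edges : {set vertex * vertex};
  col : {e : vertex * vertex | e \in edges} -> color;
  vertex_gt0 : (0 < #|vertex|)%N;
  graph_connected : forall x y : vertex,
    connect [rel u v | ((u, v) \in edges) || ((v, u) \in edges)] x y;
  col_surj : forall z : color, exists e, col e = z
}.

Section Graph.
Variable G : labeled_digraph.
Implicit Types (x y : vertex G) (z : color G).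

Definition edge : finType := {e : vertex G * vertex G | e \in edges G}.

Definition simple_graph : Prop :=
  (forall x, (x, x) \notin edges G) /\
  (forall x y, x != y -> ~~ (((x, y) \in edges G) && ((y, x) \in edges G))).

Definition degree x : nat :=
  (#|[set e in edges G | e.1 == x]| + #|[set e in edges G | e.2 == x]|)%N.

Definition regular_graph (s : nat) : Prop := forall x, degree x = s.

Definition incident (e : edge) x : bool := ((val e).1 == x) || ((val e).2 == x).

Definition proper_coloring : Prop := forall (e f : edge) x,
  e != f -> incident e x -> incident f x -> col e != col f.

Definition uniform_graph (p q r : nat) : Prop :=
  [/\ #|color G| = p, #|vertex G| = q,
      exists2 s, (0 < s)%N & regular_graph s,
      proper_coloring
    & forall z, #|[set e : edge | col e == z]| = r].

Definition col_edge z x y : bool :=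
  [exists e : edge, (val e == (x, y)) && (col e == z)].

Lemma col_edgeP z x y :
  reflect (exists2 e : edge, val e = (x, y) & col e = z) (col_edge z x y).
Proof.
by apply: (iffP existsP) => [[e /andP[/eqP ? /eqP ?]]|[e exy ez]]; exists e;
  rewrite // exy ez !eqxx.
Qed.

End Graph.

(* Coordinate functions with respect to the orthonormal basis V + C. *)
Definition nG (R : realType) (G : labeled_digraph) : vectType R :=
  {ffun vertex G + color G -> R^o}.

Section LieAlgebra.
Variables (R : realType) (G : labeled_digraph).
Local Notation I := (vertex G + color G)%type.
Local Notation n := (nG R G).
Implicit Types (x y z : n) (a b : I) (U : {vspace n}).

Definition coor x a : R := (x : {ffun I -> R^o}) a.

Definition basis_vec a : n := [ffun b => (b == a)%:R].

Definition vpart : {vspace n} := <<[seq basis_vec (inl i) | i : vertex G]>>%VS.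
Definition wpart : {vspace n} := <<[seq basis_vec (inr c) | c : color G]>>%VS.

Definition inner x y : R := \sum_a coor x a * coor y a.

Definition basis_bracket a b : n :=
  match a, b with
  | inl i, inl j =>
      \sum_(c : color G)
        ((col_edge c i j)%:R - (col_edge c j i)%:R) *: basis_vec (inr c)
  | _, _ => 0
  end.

Definition bracket x y : n :=
  \sum_a \sum_b (coor x a * coor y b) *: basis_bracket a b.

Lemma coorP (k : R) x y a : coor (k *: x + y) a = k * coor x a + coor y a.
Proof. by rewrite /coor !ffunE. Qed.

Lemma coor_basis a b : coor (basis_vec a) b = (b == a)%:R.
Proof. by rewrite /coor ffunE. Qed.

Lemma coor_sum (J : Type) (r : seq J) (P : pred J) (F : J -> n) a :
  coor (\sum_(i <- r | P i) F i) a = \sum_(i <- r | P i) coor (F i) a.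
Proof. by rewrite /coor sum_ffunE. Qed.

Lemma coorE x : x = \sum_a coor x a *: basis_vec a.
Proof.
apply/ffunP => b; rewrite sum_ffunE (bigD1 b) //= !ffunE eqxx.
rewrite big1 ?addr0; first by rewrite /coor /GRing.scale /= mulr1.
by move=> a /negPf ab; rewrite !ffunE eq_sym ab scaler0.
Qed.

Lemma vpartP x : reflect (forall c, coor x (inr c) = 0) (x \in vpart).
Proof.
apply: (iffP idP) => [/coord_span -> c|xw].
  rewrite coor_sum big1 // => k _; rewrite /coor ffunE -/(coor _ _).
  have /mapP[i _ ->] : (image_tuple (fun i => basis_vec (inl i)) (vertex G))`_k
    \in [seq basis_vec (inl i) | i : vertex G].
    by apply: mem_nth; rewrite size_tuple.
  by rewrite coor_basis scaler0.
rewrite [x]coorE big_sumType /= [X in _ + X]big1 ?addr0 => [|c _]; last first.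
  by rewrite xw scale0r.
apply: memv_suml => i _; apply/memvZ/memv_span.
by apply/mapP; exists i; rewrite ?mem_enum.
Qed.

Lemma wpartP x : reflect (forall i, coor x (inl i) = 0) (x \in wpart).
Proof.
apply: (iffP idP) => [/coord_span -> i|xv].
  rewrite coor_sum big1 // => k _; rewrite /coor ffunE -/(coor _ _).
  have /mapP[c _ ->] : (image_tuple (fun c => basis_vec (inr c)) (color G))`_k
    \in [seq basis_vec (inr c) | c : color G].
    by apply: mem_nth; rewrite size_tuple.
  by rewrite coor_basis scaler0.
rewrite [x]coorE big_sumType /= big1 ?add0r => [|i _]; last first.
  by rewrite xv scale0r.
apply: memv_suml => c _; apply/memvZ/memv_span.
by apply/mapP; exists c; rewrite ?mem_enum.
Qed.

Lemma cap_wv : (wpart :&: vpart)%VS = 0%VS.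
Proof.
apply/eqP; rewrite -subv0; apply/subvP => x /memv_capP[/wpartP xv /vpartP xw].
by rewrite memv0; apply/eqP/ffunP => -[i|c]; rewrite ffunE; [apply: xv|apply: xw].
Qed.

Fact inner_bilinear :
  bilinear_for (GRing.Scale.Law.clone _ _ *%R _)
    (GRing.Scale.Law.clone _ _ (@idfun R \; *%R) _) inner.
Proof.
split=> [y k x x'|x k y y'] /=; rewrite /inner mulr_sumr -big_split /=;
  apply: eq_bigr => a _; rewrite coorP ?mulrDl ?mulrDr ?mulrA //.
by rewrite [coor x a * k]mulrC.
Qed.

HB.instance Definition _ := @bilinear_isBilinear.Build R n n R _ _ inner
  inner_bilinear.

Fact inner_sym x y : inner x y = (-1) ^+ false * idfun (inner y x).
Proof.
by rewrite expr0 mul1r; apply: eq_bigr => a _; rewrite mulrC.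
Qed.

HB.instance Definition _ :=
  @isHermitianSesquilinear.Build R n false idfun inner inner_sym.

Fact inner_pos x : x != 0 -> 0 < inner x x.
Proof.
have ge0 a : true -> 0 <= coor x a * coor x a by rewrite -expr2 sqr_ge0.
move=> x0; rewrite lt_def sumr_ge0 ?andbT //; apply: contraNneq x0 => s0.
apply/eqP/ffunP => a; rewrite ffunE.
have /eqP := psumr_eq0P ge0 s0 (i := a) isT.
by rewrite mulf_eq0 orbb => /eqP.
Qed.

HB.instance Definition _ := @isDotProduct.Build R n inner inner_pos.

Fact bracket_bilinear :
  bilinear_for (GRing.Scale.Law.clone _ _ *:%R _)
    (GRing.Scale.Law.clone _ _ *:%R _) bracket.
Proof.
split=> [y k x x'|x k y y'] /=; rewrite /bracket scaler_sumr -big_split /=;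
  apply: eq_bigr => a _; rewrite scaler_sumr -big_split /=;
  apply: eq_bigr => b _; rewrite coorP scalerA -scalerDl;
  by rewrite ?mulrDl ?mulrDr !mulrA ?[coor x a * k]mulrC.
Qed.

HB.instance Definition _ := @bilinear_isBilinear.Build R n n n _ _ bracket
  bracket_bilinear.

Lemma bracket_basis a b : bracket (basis_vec a) (basis_vec b) = basis_bracket a b.
Proof.
rewrite /bracket (bigD1 a) //= [X in _ + X]big1 ?addr0 => [|c /negPf ca].
  rewrite (bigD1 b) //= big1 ?addr0 => [|c /negPf cb].
    by rewrite !coor_basis !eqxx mulr1 scale1r.
  by rewrite !coor_basis cb mulr0 scale0r.
by rewrite big1 // => d _; rewrite coor_basis ca mul0r scale0r.
Qed.

Lemma bracket_skew x y : bracket x y = - bracket y x.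
Proof.
have basis_skew a b : basis_bracket a b = - basis_bracket b a.
  case: a b => [i|c] [j|d] /=; rewrite ?oppr0 // -sumrN.
  by apply: eq_bigr => c _; rewrite -scaleNr opprB.
rewrite /bracket exchange_big -sumrN; apply: eq_bigr => b _.
rewrite -sumrN; apply: eq_bigr => a _.
by rewrite basis_skew scalerN mulrC.
Qed.

Definition center : {vspace n} :=
  (\bigcap_(a : I) lker (linfun (applyr bracket (basis_vec a))))%VS.

Lemma centerP x : reflect (forall y, bracket x y = 0) (x \in center).
Proof.
apply: (iffP idP) => [xz y|xz].
  rewrite [y]coorE linear_sumr big1 // => a _; rewrite linearZr_LR /=.
  have /subv_bigcapP/(_ a isT) : (<[x]> <= center)%VS by rewrite -memvE.
  by rewrite -memvE memv_ker lfunE => /eqP /= ->; rewrite scaler0.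
rewrite memvE; apply/subv_bigcapP => a _.
by rewrite -memvE memv_ker lfunE /= xz.
Qed.

(* [n_G, n_G] *)
Definition derived : {vspace n} :=
  <<[seq bracket (basis_vec ab.1) (basis_vec ab.2) | ab : I * I]>>%VS.

Lemma bracket_derived x y : bracket x y \in derived.
Proof.
rewrite memv_suml // => a _; rewrite memv_suml // => b _; apply: memvZ.
rewrite -bracket_basis; apply: memv_span.
by apply/mapP; exists (a, b); rewrite ?mem_enum.
Qed.

(* j z is an endomorphism of the whole space: it vanishes on w, takes its values
   in v, and restricts to the operator j(z) : v -> v (see j_adjoint). *)
Definition j_fun z x : n :=
  \sum_(i : vertex G) inner z (bracket x (basis_vec (inl i))) *: basis_vec (inl i).

Fact j_fun_linear z : linear (j_fun z).
Proof.
move=> k x y; rewrite /j_fun scaler_sumr -big_split /=; apply: eq_bigr => i _.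
by rewrite linearPl linearPr scalerA -scalerDl.
Qed.

HB.instance Definition _ z := @GRing.isLinear.Build R n n *:%R (j_fun z)
  (j_fun_linear z).

Definition j z : 'End(n) := linfun (j_fun z).

Lemma j_vpart z x : j z x \in vpart.
Proof.
rewrite lfunE /=; apply: memv_suml => i _; apply/memvZ/memv_span.
by apply/mapP; exists i; rewrite ?mem_enum.
Qed.

Lemma inner_basis x a : inner (basis_vec a) x = coor x a.
Proof.
rewrite /inner (bigD1 a) //= coor_basis eqxx mul1r big1 ?addr0 // => b /negPf ba.
by rewrite coor_basis ba mul0r.
Qed.

Lemma j_adjoint z x y : x \in vpart -> y \in vpart ->
  inner (j z x) y = inner z (bracket x y).
Proof.
move=> _ /vpartP yv; have yE : y = \sum_i coor y (inl i) *: basis_vec (inl i).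
  rewrite {1}[y]coorE big_sumType /= [X in _ + X]big1 ?addr0 // => c _.
  by rewrite yv scale0r.
rewrite yE linear_sumr.
have -> : bracket x (\sum_i coor y (inl i) *: basis_vec (inl i)) =
    \sum_i coor y (inl i) *: bracket x (basis_vec (inl i)).
  by rewrite linear_sumr; apply: eq_bigr => i _; rewrite linearZr_LR.
rewrite linear_sumr; apply: eq_bigr => i _; rewrite !linearZr_LR /=; congr (_ * _).
rewrite lfunE /= /j_fun linear_sumlz (bigD1 i) //= linearZl_LR /= inner_basis.
rewrite coor_basis eqxx mulr1 big1 ?addr0 // => l /negPf li.
by rewrite linearZl_LR /= inner_basis coor_basis -[inl _ == inl _]/(l == i) li mulr0.
Qed.

Definition center_orth : {vspace n} := orthov inner center.

(* For a simple graph exactly one subspace satisfies this predicate: see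
   is_abelian_factorP below. *)
Definition is_abelian_factor (a : {vspace n}) : Prop :=
  [/\ (a <= vpart)%VS, center = (derived + a)%VS & directv (derived + a)].

Lemma derivedE : simple_graph G -> derived = wpart.
Proof.
move=> [noloop noanti]; apply/eqP; rewrite eqEsubv; apply/andP; split.
  apply/span_subvP => _ /mapP[[a b] _ ->]; rewrite bracket_basis.
  case: a b => [i|c] [k|d] /=; rewrite ?mem0v //.
  apply: memv_suml => c _; apply/memvZ/memv_span.
  by apply/mapP; exists c; rewrite ?mem_enum.
apply/span_subvP => _ /mapP[c _ ->]; have [e ec] := col_surj c.
case De: (val e) (valP e) => [i k] ik.
suff <- : bracket (basis_vec (inl i)) (basis_vec (inl k)) = basis_vec (inr c).
  exact: bracket_derived.
have ki : (k, i) \notin edges G.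
  have [<-|ik'] := eqVneq i k; first exact: noloop.
  by have := noanti _ _ ik'; rewrite ik.
rewrite bracket_basis /= (bigD1 c) //= big1 ?addr0 => [|d dc].
  have -> : col_edge c i k by apply/col_edgeP; exists e.
  rewrite (_ : col_edge c k i = false) ?subr0 ?scale1r //.
  apply/col_edgeP => -[f fki _].
  by have := valP f; rewrite fki (negPf ki).
rewrite (_ : col_edge d k i = false); last first.
  apply/col_edgeP => -[f fki _].
  by have := valP f; rewrite fki (negPf ki).
rewrite (_ : col_edge d i k = false) ?subrr ?scale0r //.
apply/col_edgeP => -[f fik fd].
have fe : f = e by apply: val_inj; rewrite fik De.
by rewrite -fd fe ec eqxx in dc.
Qed.

Lemma is_abelian_factorP (a : {vspace n}) : simple_graph G ->
  is_abelian_factor a <-> a = (center :&: vpart)%VS.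
Proof.
move=> /derivedE; rewrite /is_abelian_factor => ->; split=> [[av zE _]|->].
  apply/eqP; rewrite eqEsubv subv_cap av zE addvSr /=.
  apply/subvP => _ /memv_capP[/memv_addP[u uw [t ta ->]]] uv.
  suff -> : u = 0 by rewrite add0r.
  apply/eqP; rewrite -memv0 -cap_wv memv_cap uw.
  by rewrite -(addrK t u) memvB // (subvP av).
have wz : (wpart <= center)%VS.
  apply/span_subvP => _ /mapP[c _ ->]; apply/centerP => y.
  rewrite [y]coorE linear_sumr big1 // => b _.
  by rewrite linearZr_LR /= bracket_basis scaler0.
split; first exact: capvSr; last first.
  by rewrite directv_addE /= !directvE /= !eqxx (capvC center) capvA cap_wv cap0v eqxx.
apply/eqP; rewrite eqEsubv subv_add wz capvSl !andbT; apply/subvP => x xz.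
pose u : n := \sum_c coor x (inr c) *: basis_vec (inr c).
have uw : u \in wpart.
  apply: memv_suml => c _; apply/memvZ/memv_span.
  by apply/mapP; exists c; rewrite ?mem_enum.
rewrite -(subrK u x) addrC memv_add // memv_cap memvB //= ?(subvP wz) //.
rewrite [x]coorE big_sumType /= addrK; apply: memv_suml => i _.
by apply/memvZ/memv_span/mapP; exists i; rewrite ?mem_enum.
Qed.

Definition singular_on (U : {vspace n}) (f : 'End(n)) : Prop :=
  (lker f :&: U)%VS <> 0%VS.

Definition singular : Prop :=
  forall z, z \in derived -> singular_on center_orth (j z).

Definition nonsingular : Prop :=
  (exists2 a, is_abelian_factor a & a = 0%VS) /\
  (forall z, z \in derived -> z != 0 -> ~ singular_on vpart (j z)).

Definition almost_nonsingular : Prop := ~ singular /\ ~ nonsingular.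

End LieAlgebra.

(* Main.v *)
Require Import Defs.
From mathcomp Require Import all_boot all_order all_algebra.
From mathcomp Require Import sesquilinear boolp reals.

(** When every vertex has as many edges as there are colors, properness makes
    each color appear exactly once at each vertex: the [p] edges at a vertex
    have pairwise distinct colors, hence exhaust the [p] colors
    ([exists_edge_of_color]).  So the edges of one fixed color [c] form a
    perfect matching of the vertices, and [j Z_c] sends each basis vector of
    [v] to plus or minus its partner in that matching.  It is therefore
    injective on [v] ([ker_j_color]).  The orthogonal complement of the center
    lies inside [v], because the center contains [w] ([center_orth_sub]).  Hence
    [j Z_c] witnesses that the Lie algebra is not singular; nonsingular or
    almost nonsingular is then excluded middle. *)

Set Implicit Arguments.
Unset Strict Implicit.
Unset Printing Implicit Defensive.

Import GRing.Theory.

Local Open Scope ring_scope.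

Section Matching.
Variable G : labeled_digraph.
Hypothesis noloop : forall x : vertex G, (x, x) \notin edges G.

(** [degree] adds out-degree and in-degree; without loops no edge is counted
    twice. *)
Lemma card_incident (x : vertex G) :
  #|[set e : edge G | incident e x]| = degree x.
Proof.
have -> : degree x =
    #|[set e in edges G | (e.1 == x) || (e.2 == x)]|.
  rewrite /degree -cardsUI [X in (_ + X)%N]eq_card0 ?addn0 => [|[u v]].
    by apply: eq_card => e; rewrite !inE -andb_orr.
  rewrite !inE /=; apply/negP => /andP[/andP[uv /eqP ux] /andP[_ /eqP vx]].
  by move: (noloop x); rewrite -{1}ux -vx uv.
rewrite -(card_imset _ val_inj); apply: eq_card => e; rewrite !inE.
apply/imsetP/andP => [[f]|[eG ex]].
  by rewrite inE => fx ->; split; [exact: valP | exact: fx].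
by exists (Sub e eG); rewrite ?SubK // inE /incident SubK.
Qed.

Hypothesis proper : proper_coloring G.

(** Pigeonhole: coloring is injective on the edges at [x], which are as many as
    the colors. *)
Lemma exists_edge_of_color (x : vertex G) (c : color G) :
  degree x = #|color G| -> exists2 e : edge G, incident e x & Defs.col e = c.
Proof.
move=> deg_x; pose star := [set e : edge G | incident e x].
have col_inj : {in star &, injective (@Defs.col G)}.
  move=> e f; rewrite !inE => ex fx ef; apply/eqP; apply: contraT => e_f.
  by have := proper e_f ex fx; rewrite ef eqxx.
have /eqP imT : @Defs.col G @: star == [set: color G].
  rewrite eqEcard subsetT cardsT (card_in_imset col_inj) card_incident deg_x.
  exact: leqnn.
have /imsetP[e] : c \in @Defs.col G @: star by rewrite imT inE.
by rewrite inE => ex ->; exists e.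
Qed.

End Matching.

Section Operator.
Variables (R : realType) (G : labeled_digraph).

Lemma coor_bracket_color (u : nG R G) (y : vertex G) (c : color G) :
  coor (bracket u (basis_vec R (inl y))) (inr c) =
  \sum_x coor u (inl x) * ((col_edge c x y)%:R - (col_edge c y x)%:R).
Proof.
rewrite {1}[u]coorE linear_sumlz coor_sum big_sumType /=.
rewrite [X in _ + X]big1 ?addr0 => [|d _]; last first.
  by rewrite linearZl_LR /= bracket_basis scaler0 /coor ffunE.
apply: eq_bigr => x _; rewrite linearZl_LR /= bracket_basis -[_ *: _]addr0 coorP.
rewrite [coor 0 _]ffunE addr0 coor_sum (bigD1 c) //= big1 ?addr0 => [|d dc].
  rewrite -[_ *: basis_vec _ _]addr0 coorP coor_basis eqxx mulr1.
  by rewrite [coor 0 _]ffunE addr0.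
rewrite -[_ *: basis_vec _ _]addr0 coorP coor_basis [coor 0 _]ffunE addr0.
by rewrite -[inr _ == inr _]/(c == d) eq_sym (negPf dc) mulr0.
Qed.

Lemma coor_j_color (c : color G) (u : nG R G) (y : vertex G) :
  coor (j (basis_vec R (inr c)) u) (inl y) =
  \sum_x coor u (inl x) * ((col_edge c x y)%:R - (col_edge c y x)%:R).
Proof.
rewrite -inner_basis lfunE /= /j_fun linear_sumr (bigD1 y) //= linearZr_LR /=.
rewrite !inner_basis coor_basis eqxx mulr1 coor_bracket_color.
rewrite [X in _ + X]big1 ?addr0 // => l ly; rewrite linearZr_LR /= !inner_basis coor_basis.
by rewrite -[inl _ == inl _]/(y == l) eq_sym (negPf ly) mulr0.
Qed.

(** If [x] and [y] are matched by an edge of color [c], then up to sign the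
    [y]-coordinate of [j Z_c u] is the [x]-coordinate of [u]; as every [x] is
    matched, [j Z_c u = 0] forces [u = 0] on [v]. *)
Lemma ker_j_color (c : color G) :
  simple_graph G -> proper_coloring G ->
  (forall x : vertex G, exists2 e : edge G, incident e x & Defs.col e = c) ->
  (lker (j (basis_vec R (inr c))) :&: vpart R G)%VS = 0%VS.
Proof.
move=> [noloop noanti] proper matched; apply/eqP; rewrite -subv0; apply/subvP => u.
case/memv_capP; rewrite memv_ker => /eqP ju0 /vpartP uw.
rewrite memv0; apply/eqP/ffunP => -[x|d]; rewrite ffunE; last exact: uw.
have [e ex ec] := matched x.
have [y xy De] : exists2 y, x != y & val e = (x, y) \/ val e = (y, x).
  move: (valP e) ex; rewrite /incident; case: (val e) => a b ab /=.
  have a_b : a != b by apply: contraTneq ab => ->; exact: noloop.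
  case/orP => /eqP <-; first by exists b => //; left.
  by exists a; [rewrite eq_sym | right].
(* Properness: the edge [e] is the only edge of color [c] at [y], so [x] is
   the only neighbor of [y] through that color. *)
have unmatched x' : x' != x ->
    (col_edge c x' y)%:R - (col_edge c y x')%:R = 0 :> R.
  move=> x'x; suff no_edge a b :
      (a, b) = (x', y) \/ (a, b) = (y, x') -> col_edge c a b = false.
    by rewrite !no_edge ?subrr //; [right | left].
  move=> ab; apply/col_edgeP => -[f Df fc].
  have [fx' fy] : incident f x' /\ incident f y.
    by rewrite /incident Df; case: ab => -[-> ->]; rewrite !eqxx ?orbT.
  have ey : incident e y.
    by rewrite /incident; case: De => ->; rewrite /= eqxx ?orbT.
  have fe : f = e.
    apply/eqP; apply: contraT => f_e.
    by have := proper f e y f_e fy ey; rewrite fc ec eqxx.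
  have x'y : x' = y.
    move: fx'; rewrite fe /incident.
    by case: De => -> /= /orP[] /eqP // xx'; move: x'x; rewrite xx' eqxx.
  have := valP f; rewrite Df; case: ab => ->; rewrite x'y => yy;
    by move: (noloop y); rewrite yy.
(* No cancellation in the surviving coefficient: the edge joining [x] and [y]
   has only one orientation. *)
have edge_asym a b : (a, b) \in edges G -> col_edge c b a = false.
  move=> ab; apply/col_edgeP => -[f Df _]; have := valP f; rewrite Df => ba.
  have a_b : a != b by apply: contraTneq ab => ->; exact: noloop.
  by have := noanti _ _ a_b; rewrite ab ba.
have := coor_j_color c u y.
rewrite ju0 [coor 0 _]ffunE (bigD1 x) //= big1 => [|x' x'x].
  rewrite addr0; have := valP e; case: De => De; rewrite De => eG.
    have -> : col_edge c x y by apply/col_edgeP; exists e.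
    by rewrite (edge_asym _ _ eG) subr0 mulr1.
  have -> : col_edge c y x by apply/col_edgeP; exists e.
  by rewrite (edge_asym _ _ eG) sub0r mulrN1 => /esym/eqP; rewrite oppr_eq0 => /eqP.
by rewrite unmatched // mulr0.
Qed.

Lemma basis_color_center (c : color G) : basis_vec R (inr c) \in center R G.
Proof.
apply/centerP => y; rewrite [y]coorE linear_sumr big1 // => b _.
by rewrite linearZr_LR /= bracket_basis scaler0.
Qed.

Lemma center_orth_sub : (center_orth R G <= vpart R G)%VS.
Proof.
apply/subvP => u /mem_orthovP uz; apply/vpartP => c.
by rewrite -inner_basis inner_sym expr0 mul1r; apply/uz/basis_color_center.
Qed.

End Operator.

Theorem proposition6p8 (R : realType) (G : labeled_digraph) (p q r s : nat)
    (G_simple : simple_graph G) (G_uniform : uniform_graph G p q r)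
    (q_even : ~~ odd q) (G_regular : regular_graph G s) (s_eq_p : s = p) :
  nonsingular R G \/ almost_nonsingular R G.
Proof.
have [color_p _ [s' s'_gt0 deg_s'] proper _] := G_uniform.
have deg_color (x : vertex G) : degree x = #|color G|
  by rewrite color_p -s_eq_p; exact: G_regular.
have [x0 _] := card_gt0P (vertex_gt0 G).
have /card_gt0P[c _] : (0 < #|color G|)%N by rewrite -(deg_color x0) deg_s'.
have [|not_nonsing] := pselect (nonsingular R G); first by left.
right; split=> // sing; apply: (sing (basis_vec R (inr c))).
  rewrite derivedE //; apply/wpartP => i; exact: coor_basis.
have matched (x : vertex G) : exists2 e : edge G, incident e x & Defs.col e = c.
  by case: G_simple => noloop _; apply: exists_edge_of_color.
apply/eqP; rewrite -subv0 -(ker_j_color R G_simple proper matched).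
exact/capvS/center_orth_sub.
Qed.
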